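(* Let $\Gamma$ be finite and let $x\in M_n(\mathcal A)$ be self-adjoint. Then the Cauchy transform $G(z)=\int_{\mathbb R}\frac{d\nu(t)}{z-t}$ of the law $\nu$ of $x$ with respect to $\mathrm{Tr}\otimes\mathrm{tr}_n$ is algebraic, i.e. its expansion as a power series in $1/z$ satisfies a nontrivial polynomial equation $\sum_{j=0}^m Q_j(1/z)G^j=0$ with polynomials $Q_j$ not all zero.
   Context: $\Gamma$ is a finite connected undirected graph (loops, multiple edges allowed), vertex set $V$, weighting $\mu:V\to(0,\infty)$. Directed version $\vec\Gamma$: each edge with distinct endpoints $\alpha\ne\beta$ yields $\epsilon,\epsilon^{op}$ with $s(\epsilon)=t(\epsilon^{op})=\alpha$, $t(\epsilon)=s(\epsilon^{op})=\beta$; each loop yields one directed loop $\epsilon=\epsilon^{op}$. $\mathcal C=C_0(V)$, $p_\alpha$ indicator of $\alpha$; $\mathcal X$ the Hilbert $\mathcal C$-$\mathcal C$ bimodule spanned by directed edges with $p_\alpha\epsilon=\delta_{s(\epsilon),\alpha}\epsilon$, $\epsilon p_\alpha=\delta_{t(\epsilon),\alpha}\epsilon$, $\langle\epsilon'|\epsilon\rangle=\delta_{\epsilon,\epsilon'}p_{t(\epsilon)}$; $\mathcal F(\mathcal X)$ its full Fock space with creation operators $\ell(\xi)$. For a loop $e$: $X_e=\ell(\epsilon)+\ell(\epsilon)^*$; for $e$ with endpoints $\alpha\ne\beta$: $a_\epsilon=(\mu(\alpha)/\mu(\beta))^{1/4}$, $X_e=a_\epsilon\ell(\epsilon)+a_\epsilon^{-1}\ell(\epsilon^{op})^*+a_\epsilon^{-1}\ell(\epsilon^{op})+a_\epsilon\ell(\epsilon)^*$;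 $X_\epsilon=p_{s(\epsilon)}X_ep_{t(\epsilon)}$. $\mathcal S(\Gamma,\mu)$ is the C$^*$-algebra generated by $\mathcal C$ and the $X_e$; $\mathrm{Tr}=\mathrm{tr}\circ E$ with $E(x)=PxP$ ($P$ projection onto $\mathcal C$), $\mathrm{tr}(p_v)=\mu(v)$ (a finite faithful trace since $\Gamma$ is finite). $\mathcal A$ is the $*$-algebra generated by $\{p_\beta\}\cup\{X_\epsilon\}$. $\mathrm{tr}_n$ is the trace on $M_n(\mathbb C)$. The law of a self-adjoint $x$ with respect to a faithful positive trace $\phi$ is the unique positive measure $\nu$ with $\phi(x^k)=\int t^k\,d\nu(t)$ for all $k\ge0$. *)

(* Defs.v *)
From HB Require Import structures.
From mathcomp Require Import all_boot all_order all_algebra.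
From mathcomp Require Import reals Rstruct complex.

Set Implicit Arguments.
Unset Strict Implicit.
Unset Printing Implicit Defensive.
Import Order.TTheory GRing.Theory Num.Theory.
Local Open Scope ring_scope.

Definition RR : realType := Rdefinitions.R.
Definition CC := (RR[i])%type.

(* ---------- the graph ----------------------------------------------------
   A finite undirected multigraph with loops: vertex set V and edge set E
   (finite types), [ends e = (a,b)] the (unordered) pair of endpoints of e,
   stored in an arbitrary order. *)

Definition adjacent (V E : finType) (ends : E -> V * V) : rel V :=
  fun a b => [exists e, (ends e == (a, b)) || (ends e == (b, a))].

Definition connected_graph (V E : finType) (ends : E -> V * V) : Prop :=
  (0 < #|V|)%N /\ forall a b : V, connect (adjacent ends) a b.

(* ---------- the directed graph ------------------------------------------
   A directed edge is a pair (e, b) : E * bool.  (e, true) runs from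
   (ends e).1 to (ends e).2 and (e, false) is its opposite; for a loop only
   (e, true) is a directed edge. *)

Definition is_loop (V E : finType) (ends : E -> V * V) (e : E) : bool :=
  (ends e).1 == (ends e).2.

Definition valid_dedge (V E : finType) (ends : E -> V * V) (d : E * bool) :=
  d.2 || ~~ is_loop ends d.1.

Definition dsrc (V E : finType) (ends : E -> V * V) (d : E * bool) : V :=
  if d.2 then (ends d.1).1 else (ends d.1).2.

Definition dtgt (V E : finType) (ends : E -> V * V) (d : E * bool) : V :=
  if d.2 then (ends d.1).2 else (ends d.1).1.

(* ---------- the full Fock space ------------------------------------------
   Orthonormal-basis index: a pair (v, w) with w = [:: d1; ...; dk] a word of
   directed edges forming a path d1 d2 ... dk (t(d_i) = s(d_{i+1})) ending at
   t(dk) = v; for k = 0 this is the vacuum vector p_v.  The source of (v,w)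
   is s(d1), or v when w is empty. *)

Definition pstart (V E : finType) (ends : E -> V * V) (v : V)
  (w : seq (E * bool)) : V :=
  if w is d :: _ then dsrc ends d else v.

Fixpoint valid_path (V E : finType) (ends : E -> V * V) (v : V)
  (w : seq (E * bool)) : bool :=
  match w with
  | [::] => true
  | d :: w' => [&& valid_dedge ends d, dtgt ends d == pstart ends v w'
                 & valid_path ends v w']
  end.

(* vectors = coefficient functions on the basis; operators act on them *)
Definition Vec (V E : finType) := V -> seq (E * bool) -> CC.
Definition Op (V E : finType) := Vec V E -> Vec V E.

Definition basis (V E : finType) (v : V) (w : seq (E * bool)) : Vec V E :=
  fun v' w' => if (v' == v) && (w' == w) then 1 else 0.

Definition proj (V E : finType) (ends : E -> V * V) (a : V) : Op V E :=
  fun f v w => if pstart ends v w == a then f v w else 0.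

(* creation operator l(d) : path pi |-> d.pi (if t(d) = s(pi)) *)
Definition cre (V E : finType) (ends : E -> V * V) (d : E * bool) : Op V E :=
  fun f v w => match w with
               | d' :: w' => if (d' == d) && (dtgt ends d == pstart ends v w')
                             then f v w' else 0
               | [::] => 0
               end.

(* its adjoint l(d)^* : d.pi |-> pi, other basis vectors |-> 0 *)
Definition ann (V E : finType) (ends : E -> V * V) (d : E * bool) : Op V E :=
  fun f v w => if dtgt ends d == pstart ends v w then f v (d :: w) else 0.

Definition Xe (V E : finType) (ends : E -> V * V) (mu : V -> RR) (e : E)
  : Op V E :=
  let al := (ends e).1 in let be := (ends e).2 in
  let eps := (e, true) in let epsop := (e, false) in
  if al == be then fun f v w => cre ends eps f v w + ann ends eps f v w
  else
    let a : CC := (Num.sqrt (Num.sqrt (mu al / mu be)))%:C%C in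
    fun f v w => a * cre ends eps f v w + a^-1 * ann ends epsop f v w
               + a^-1 * cre ends epsop f v w + a * ann ends eps f v w.

Definition Xd (V E : finType) (ends : E -> V * V) (mu : V -> RR)
  (d : E * bool) : Op V E :=
  fun f => proj ends (dsrc ends d) (Xe ends mu d.1 (proj ends (dtgt ends d) f)).

(* ---------- the *-algebra A ----------------------------------------------
   Elements of A are denoted by noncommutative polynomial expressions in the
   generators p_beta and X_eps (scalars c denote c * 1 = c * sum_beta p_beta). *)
Inductive aexpr (V E : Type) :=
| AP of V
| AX of (E * bool)
| AS of CC
| AAdd of aexpr V E & aexpr V E
| AMul of aexpr V E & aexpr V E.

Fixpoint interp (V E : finType) (ends : E -> V * V) (mu : V -> RR)
  (x : aexpr V E) : Op V E :=
  match x with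
  | AP a => proj ends a
  | AX d => Xd ends mu d
  | AS c => fun f v w => c * f v w
  | AAdd x y => fun f v w => interp ends mu x f v w + interp ends mu y f v w
  | AMul x y => fun f => interp ends mu x (interp ends mu y f)
  end.

(* x in M_n(A) is self-adjoint: x_{ij}^* = x_{ji} as operators on the Fock
   space, i.e. <pi', x_{ij} pi> = conj <pi, x_{ji} pi'> for all basis paths. *)
Definition selfadjoint_mx (V E : finType) (ends : E -> V * V) (mu : V -> RR)
  (n : nat) (x : 'I_n -> 'I_n -> aexpr V E) : Prop :=
  forall (i j : 'I_n) (v : V) (w : seq (E * bool)) (v' : V)
         (w' : seq (E * bool)),
    valid_path ends v w -> valid_path ends v' w' ->
    interp ends mu (x i j) (basis v w) v' w'
    = Num.conj (interp ends mu (x j i) (basis v' w') v w).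

Definition mact (V E : finType) (ends : E -> V * V) (mu : V -> RR) (n : nat)
  (x : 'I_n -> 'I_n -> aexpr V E) (F : 'I_n -> Vec V E) : 'I_n -> Vec V E :=
  fun i v w => \sum_(j < n) interp ends mu (x i j) (F j) v w.

(* k-th moment (Tr (x) tr_n)(x^k), with tr_n the normalized trace,
   Tr = tr o E, E(y) = P y P, tr(p_v) = mu(v). *)
Definition moment (V E : finType) (ends : E -> V * V) (mu : V -> RR)
  (n : nat) (x : 'I_n -> 'I_n -> aexpr V E) (k : nat) : CC :=
  n%:R^-1 * \sum_(i < n) \sum_(v : V)
    (mu v)%:C%C * (iter k (mact ends mu x)
                     (fun j => if j == i then basis v [::] else (fun _ _ => 0)))
                     i v [::].

(* truncation at order N of the Cauchy transform as power series in w = 1/z: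
   G(w) = sum_{k>=0} m_k w^{k+1} *)
Definition cauchy_trunc (m : nat -> CC) (N : nat) : {poly CC} :=
  \sum_(k < N) m k *: 'X^(k.+1).

(* the formal power series sum_k m_k w^(k+1) is algebraic over C[w]:
   sum_{j<=M} Q_j(w) G(w)^j = 0 in C[[w]] with the Q_j not all zero.
   (Coefficient d of the product only depends on coefficients <= d,
   so it is tested on the truncations.) *)
Definition algebraic_cauchy (m : nat -> CC) : Prop :=
  exists (M : nat) (Q : 'I_M.+1 -> {poly CC}),
    (exists j, Q j != 0) /\
    forall N d : nat, (d <= N)%N ->
      (\sum_(j < M.+1) Q j * cauchy_trunc m N ^+ j)`_d = 0.

(* Main.v *)
(** The matrix [x] is linearized: its entries are sums of words in projections,
    creation and annihilation operators and scalars, padded to a common length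
    [L], so that [x] becomes a corner of [T ^ (L + 1)] for a finite matrix [T] of
    single letters.  The vacuum resolvent of [T] is governed by the generating
    functions [M v] of excursions above a path starting at [v], which solve
      [M v = 1 + u (A v M v + u sum_(d : t(d) = v) C d M (s(d)) B d M v)].
    Solutions of a polynomial system [F = a + u Phi(F)] are algebraic: deform it
    to [F i = a i + u Phi(F) i + t u F i ^ D] with [D] above the degree of [Phi].
    Up to powers of [t u], the finitely many monomials with exponents below [D]
    then span everything, so by Cayley-Hamilton each linear combination of the
    [F i] satisfies an equation over [C[t, u]]; dividing it by a power of [t] and
    setting [t = 0] yields one for the original system.  Finally one returns from
    [u] to [w = u ^ (L + 1)] by extracting exponents in a residue class. *)

Require Import Defs.
From HB Require Import structures.
From mathcomp Require Import all_boot all_order all_algebra.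
From mathcomp Require Import reals Rstruct complex boolp.

Set Implicit Arguments.
Unset Strict Implicit.
Unset Printing Implicit Defensive.
Import GRing.Theory.
Local Open Scope ring_scope.

(** * Formal power series *)

Definition fps (R : Type) := nat -> R.
(** A named coefficient map gives the coefficient lemmas a head symbol to rewrite with. *)
Definition fcoef (R : Type) (f : fps R) (n : nat) : R := f n.

Lemma fpsP (R : Type) (f g : fps R) : (forall n, fcoef f n = fcoef g n) -> f = g.
Proof. by move=> fg; apply: funext. Qed.

Section FpsRing.
Variable R : comNzRingType.
Implicit Types f g h : fps R.

HB.instance Definition _ := gen_eqMixin (fps R).
HB.instance Definition _ := gen_choiceMixin (fps R).

Let addf f g : fps R := fun n => f n + g n.
Let oppf f : fps R := fun n => - f n.
Let zerof : fps R := fun _ => 0.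

Fact fps_addA : associative addf.
Proof. by move=> f g h; apply: fpsP => n; exact: addrA. Qed.
Fact fps_addC : commutative addf.
Proof. by move=> f g; apply: fpsP => n; exact: addrC. Qed.
Fact fps_add0 : left_id zerof addf.
Proof. by move=> f; apply: fpsP => n; exact: add0r. Qed.
Fact fps_addN : left_inverse zerof oppf addf.
Proof. by move=> f; apply: fpsP => n; exact: addNr. Qed.

HB.instance Definition _ :=
  GRing.isZmodule.Build (fps R) fps_addA fps_addC fps_add0 fps_addN.

Definition fps_trunc n f : {poly R} := \poly_(i < n) fcoef f i.
Definition fps_of_poly (p : {poly R}) : fps R := fun n => p`_n.
Let mulf f g : fps R := fun n => (fps_trunc n.+1 f * fps_trunc n.+1 g)`_n.

(** Any truncation beyond [n] computes the same coefficient, so a common truncation lets the ring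
    axioms descend from [{poly R}]. *)
Let mulfE m f g n : (n < m)%N ->
  mulf f g n = (fps_trunc m f * fps_trunc m g)`_n.
Proof.
move=> ltnm; rewrite /mulf !coefM; apply: eq_bigr => i _; rewrite !coef_poly.
have lein : (i <= n)%N by rewrite -ltnS.
rewrite !ltnS lein leq_subr.
by rewrite (leq_ltn_trans lein ltnm) (leq_ltn_trans (leq_subr _ _) ltnm).
Qed.

Let mul_trunc m f g (p : {poly R}) n : (n < m)%N ->
  (fps_trunc m (mulf f g) * p)`_n = (fps_trunc m f * fps_trunc m g * p)`_n.
Proof.
move=> ltnm; rewrite !(coefM _ p); apply: eq_bigr => i _; congr (_ * _).
have ltim : (i < m)%N by exact: leq_trans (ltn_ord i) ltnm.
by rewrite coef_poly ltim [LHS](mulfE _ _ ltim).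
Qed.

Fact fps_mulC : commutative mulf.
Proof. by move=> f g; apply: fpsP => n; rewrite /fcoef /mulf mulrC. Qed.
Fact fps_mulA : associative mulf.
Proof.
move=> f g h; apply: fpsP => n.
rewrite /fcoef [in RHS]/mulf mul_trunc // (fps_mulC f) /mulf mul_trunc //.
by rewrite mulrC mulrA.
Qed.
Fact fps_mul1 : left_id (fps_of_poly 1) mulf.
Proof.
move=> f; apply: fpsP => n; rewrite /fcoef /mulf.
have -> : fps_trunc n.+1 (fps_of_poly 1) = 1.
  by apply/polyP=> -[|i]; rewrite coef_poly /fcoef /fps_of_poly //= coef1 if_same.
by rewrite mul1r coef_poly ltnSn.
Qed.
Fact fps_mulDl : left_distributive mulf addf.
Proof.
move=> f g h; apply: fpsP => n; rewrite /fcoef /mulf /addf -coefD -mulrDl.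
suff -> : fps_trunc n.+1 (addf f g) = fps_trunc n.+1 f + fps_trunc n.+1 g by [].
by apply/polyP => i; rewrite coefD !coef_poly; case: ifP => // _; rewrite addr0.
Qed.
Fact fps_one_neq0 : fps_of_poly 1 != 0.
Proof.
apply/eqP => /(congr1 (fun f => fcoef f 0)); rewrite /fcoef /fps_of_poly coef1.
by apply/eqP; exact: oner_neq0.
Qed.

HB.instance Definition _ := GRing.Zmodule_isComNzRing.Build (fps R)
  fps_mulA fps_mulC fps_mul1 fps_mulDl fps_one_neq0.

Lemma fcoefD n f g : fcoef (f + g) n = fcoef f n + fcoef g n.
Proof. by []. Qed.
Lemma fcoefN n f : fcoef (- f) n = - fcoef f n.
Proof. by []. Qed.
Lemma fcoef0 n : fcoef (0 : fps R) n = 0.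
Proof. by []. Qed.
Lemma fcoef_poly n p : fcoef (fps_of_poly p) n = p`_n.
Proof. by []. Qed.
Lemma fcoefM f g n : fcoef (f * g) n = \sum_(i < n.+1) fcoef f i * fcoef g (n - i).
Proof.
rewrite [LHS]coefM; apply: eq_bigr => i _.
by rewrite !coef_poly ltn_ord ltnS leq_subr.
Qed.
Lemma fcoef_sum I (r : seq I) (P : pred I) (F : I -> fps R) n :
  fcoef (\sum_(i <- r | P i) F i) n = \sum_(i <- r | P i) fcoef (F i) n.
Proof.
by elim/big_rec2: _ => [|i x y _ <-]; rewrite ?fcoef0 ?fcoefD.
Qed.

Fact fps_of_poly_is_additive : zmod_morphism fps_of_poly.
Proof. by move=> p q; apply: fpsP => n; rewrite fcoefD fcoefN !fcoef_poly coefB. Qed.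
Fact fps_of_poly_is_multiplicative : monoid_morphism fps_of_poly.
Proof.
by split=> // p q; apply: fpsP => n; rewrite fcoefM fcoef_poly coefM.
Qed.
HB.instance Definition _ :=
  GRing.isZmodMorphism.Build {poly R} (fps R) fps_of_poly fps_of_poly_is_additive.
HB.instance Definition _ :=
  GRing.isMonoidMorphism.Build {poly R} (fps R) fps_of_poly
    fps_of_poly_is_multiplicative.

Definition fpsX : fps R := fps_of_poly 'X.

Lemma fcoefXM f n : fcoef (fpsX * f) n = if n is m.+1 then fcoef f m else 0.
Proof.
rewrite fcoefM; case: n => [|n].
  by rewrite big_ord1 fcoef_poly coefX mul0r.
rewrite big_ord_recl big_ord_recl big1 ?addr0 => [|i _];
  rewrite !fcoef_poly !coefX ?mul0r // mul1r add0r.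
by rewrite /= /bump leq0n subSS subn0.
Qed.

Lemma fcoefCM c f n : fcoef (fps_of_poly c%:P * f) n = c * fcoef f n.
Proof.
rewrite fcoefM big_ord_recl big1 ?addr0 => [|i _];
  by rewrite fcoef_poly coefC ?mul0r //= subn0.
Qed.

End FpsRing.

Section FpsMap.
Variables (R S : comNzRingType) (phi : {rmorphism R -> S}).

Definition map_fps (f : fps R) : fps S := fun n => phi (fcoef f n).

Lemma fcoef_map f n : fcoef (map_fps f) n = phi (fcoef f n).
Proof. by []. Qed.

Fact map_fps_is_additive : zmod_morphism map_fps.
Proof. by move=> f g; apply: fpsP => n; rewrite fcoef_map !fcoefD rmorphB. Qed.
Fact map_fps_is_multiplicative : monoid_morphism map_fps.
Proof.
split=> [|f g]; apply: fpsP => n.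
  by rewrite fcoef_map !fcoef_poly !coef1 rmorph_nat.
rewrite fcoef_map !fcoefM rmorph_sum; apply: eq_bigr => i _.
by rewrite rmorphM.
Qed.
HB.instance Definition _ :=
  GRing.isZmodMorphism.Build (fps R) (fps S) map_fps map_fps_is_additive.
HB.instance Definition _ :=
  GRing.isMonoidMorphism.Build (fps R) (fps S) map_fps map_fps_is_multiplicative.

Lemma map_fps_of_poly p : map_fps (fps_of_poly p) = fps_of_poly (map_poly phi p).
Proof. by apply: fpsP => n; rewrite fcoef_map !fcoef_poly coef_map. Qed.

Lemma map_fpsX : map_fps (fpsX R) = fpsX S.
Proof. by rewrite map_fps_of_poly map_polyX. Qed.

End FpsMap.

(** * Congruence modulo powers of the variable, and contractions *)

Section Congruence.
Variable R : comNzRingType.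
Implicit Types f g : fps R.

Definition eqfps n f g := forall d, (d < n)%N -> fcoef f d = fcoef g d.

Lemma eqfpsxx n f : eqfps n f f.
Proof. by []. Qed.
Lemma eqfpsD n f g f' g' : eqfps n f f' -> eqfps n g g' -> eqfps n (f + g) (f' + g').
Proof. by move=> ff gg d dn; rewrite !fcoefD ff ?gg. Qed.
Lemma eqfpsM n f g f' g' : eqfps n f f' -> eqfps n g g' -> eqfps n (f * g) (f' * g').
Proof.
move=> ff gg d dn; rewrite !fcoefM; apply: eq_bigr => i _.
rewrite ff ?gg //; first exact: leq_ltn_trans (leq_subr _ _) dn.
exact: leq_ltn_trans (leq_ord i) dn.
Qed.
Lemma eqfps_sum n I (r : seq I) (F G : I -> fps R) :
  (forall i, eqfps n (F i) (G i)) -> eqfps n (\sum_(i <- r) F i) (\sum_(i <- r) G i).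
Proof. by move=> FG; elim/big_ind2: _ => // *; exact: eqfpsD. Qed.
Lemma eqfps_prod n I (r : seq I) (F G : I -> fps R) :
  (forall i, eqfps n (F i) (G i)) -> eqfps n (\prod_(i <- r) F i) (\prod_(i <- r) G i).
Proof. by move=> FG; elim/big_ind2: _ => // *; exact: eqfpsM. Qed.
Lemma eqfps_exp n k f g : eqfps n f g -> eqfps n (f ^+ k) (g ^+ k).
Proof. by move=> fg; elim: k => // k IH; rewrite !exprS; exact: eqfpsM. Qed.
Lemma eqfpsXM n f g : eqfps n f g -> eqfps n.+1 (fpsX R * f) (fpsX R * g).
Proof. by move=> fg [|d] dn; rewrite !fcoefXM // fg. Qed.

(** Each application of [Psi] gains one correct coefficient, so the iterates from 0 stabilize
    coefficientwise. *)
Lemma fps_contraction_fixpoint (I : Type) (Psi : (I -> fps R) -> I -> fps R) :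
  (forall n F G, (forall i, eqfps n (F i) (G i)) ->
     forall i, eqfps n.+1 (Psi F i) (Psi G i)) ->
  exists F, forall i, F i = Psi F i.
Proof.
move=> contr; pose Y k := iter k Psi (fun _ => 0).
have YS k i : eqfps k (Y k i) (Y k.+1 i).
  by elim: k i => [//|k IH] i; exact: contr.
have Yle k l i : (k <= l)%N -> eqfps k (Y k i) (Y l i).
  move=> /subnK <-; elim: (l - k)%N => [//|m IH] d dk.
  by rewrite IH // YS // (leq_trans dk) ?leq_addl.
pose F i : fps R := fun d => fcoef (Y d.+1 i) d.
have FY k i : eqfps k (F i) (Y k i) by move=> d dk; apply: (Yle d.+1).
exists F => i; apply: fpsP => d.
(* [F] and [Y d] agree below [d], so [Psi F] and [Psi (Y d)], which is [Y d.+1], agree at [d]. *)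
by rewrite (contr d F (Y d)) // => j; exact: FY.
Qed.

End Congruence.

(** * Algebraicity of solutions of polynomial systems *)

Section FiniteSpan.
Variables (A : idomainType) (S : comNzRingType) (iota : {rmorphism A -> S}).

(* Cayley-Hamilton: multiplication by [d * g] preserves the span of a finite
   family containing [1], so [d * g] is a root of a characteristic polynomial. *)
Lemma finite_span_root (T : finType) (v : T -> S) (t0 : T) (d : A) (g : S)
    (B : T -> T -> A) :
  v t0 = 1 -> d != 0 ->
  (forall a, iota d * g * v a = \sum_b iota (B a b) * v b) ->
  exists2 chi : {poly A}, chi != 0 & (map_poly iota chi).[g] = 0.
Proof.
move=> vt0 d0 eqB.
pose M : 'M[A]_#|T| := \matrix_(i, j) B (enum_val i) (enum_val j).
pose V : 'cV[S]_#|T| := \col_i v (enum_val i).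
pose h := iota d * g.
have MV : (h%:M - map_mx iota M) *m V = 0.
  apply/matrixP=> i j; rewrite mulmxBl mul_scalar_mx !mxE eqB.
  rewrite (reindex_onto enum_val enum_rank) => [|x _]; last by rewrite enum_rankK.
  under eq_bigl do rewrite enum_valK eqxx.
  by apply/eqP; rewrite subr_eq0; apply/eqP/eq_bigr => k _; rewrite !mxE.
have det0 : \det (h%:M - map_mx iota M) = 0.
  (* The adjugate turns [MV] into the vanishing of the determinant times [V]; the entry at [t0],
     where [v] is 1, suffices even if [S] has zero divisors. *)
  have /matrixP/(_ (enum_rank t0) 0) :
      \det (h%:M - map_mx iota M) *: V = 0.
    by rewrite -mul_scalar_mx -mul_adj_mx -mulmxA MV mulmx0.
  by rewrite !mxE enum_rankK vt0 mulr1.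
have size_dX : size (d *: 'X : {poly A}) = 2 by rewrite size_scale // size_polyX.
(* Substituting [d *: 'X] moves the root from [h] to [g], and over a domain it preserves being
   nonzero. *)
exists (char_poly M \Po (d *: 'X)).
  by rewrite comp_poly2_eq0 // monic_neq0 // char_poly_monic.
rewrite map_comp_poly map_polyZ map_polyX horner_comp hornerZ hornerX -/h.
rewrite map_char_poly /char_poly -horner_evalE -det_map_mx -[RHS]det0.
congr (\det _); apply/matrixP=> i j; rewrite !mxE /=.
by rewrite horner_evalE hornerD hornerN hornerC hornerMn hornerX.
Qed.

End FiniteSpan.

(** * Reduction of monomials modulo a deformed system *)

Section Reduction.
Variables (A : idomainType) (S : comNzRingType) (iota : {rmorphism A -> S}).
Variables (I J : finType) (D : nat) (c : A) (y : I -> S) (a : I -> A)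
          (coef : I -> J -> A) (idx : I -> J -> seq I).
Hypothesis c_neq0 : c != 0.
Hypothesis D_gt1 : (1 < D)%N.
Hypothesis size_idx : forall i t, (size (idx i t) < D)%N.
Hypothesis y_eq : forall i,
  iota c * y i ^+ D = y i - iota (a i)
                      - \sum_t iota (coef i t) * \prod_(j <- idx i t) y j.

Let mon (b : {ffun I -> 'I_D}) : S := \prod_i y i ^+ b i.
(** Membership in the span of the reduced monomials after inverting [c], with explicit
    denominators. *)
Let inspan (s : S) := exists (K : nat) (B : {ffun I -> 'I_D} -> A),
  iota c ^+ K * s = \sum_b iota (B b) * mon b.

Let inspanZ x s : inspan s -> inspan (iota x * s).
Proof.
move=> [K [B eqB]]; exists K, (fun b => x * B b).
by rewrite mulrCA eqB mulr_sumr; apply: eq_bigr => b _; rewrite rmorphM mulrA.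
Qed.

Let inspanMc s : inspan (iota c * s) -> inspan s.
Proof. by move=> [K [B eqB]]; exists K.+1, B; rewrite exprSr -mulrA. Qed.

Let inspan_lift K K' s B : (K <= K')%N ->
  iota c ^+ K * s = \sum_b iota (B b) * mon b ->
  iota c ^+ K' * s = \sum_b iota (c ^+ (K' - K) * B b) * mon b.
Proof.
move=> leK eqB; rewrite -{1}(subnK leK) exprD -mulrA eqB mulr_sumr.
by apply: eq_bigr => b _; rewrite rmorphM rmorphXn mulrA.
Qed.

Let inspanD s s' : inspan s -> inspan s' -> inspan (s + s').
Proof.
move=> [K [B eqB]] [K' [B' eqB']].
exists (maxn K K'), (fun b => c ^+ (maxn K K' - K) * B b + c ^+ (maxn K K' - K') * B' b).
rewrite mulrDr (inspan_lift (leq_maxl K K') eqB) (inspan_lift (leq_maxr K K') eqB').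
by rewrite -big_split; apply: eq_bigr => b _ /=; rewrite -mulrDl rmorphD.
Qed.

Let inspan0 : inspan 0.
Proof.
by exists 0%N, (fun _ => 0); rewrite mulr0 big1 // => b _; rewrite rmorph0 mul0r.
Qed.

Let inspan_sum (T : Type) (r : seq T) (F : T -> S) :
  (forall i, inspan (F i)) -> inspan (\sum_(i <- r) F i).
Proof. by move=> hF; elim/big_ind: _. Qed.

Let prod_count (l : seq I) : \prod_(j <- l) y j = \prod_i y i ^+ count_mem i l.
Proof.
elim: l => [|k l IH]; first by rewrite big_nil big1.
rewrite big_cons IH; under [RHS]eq_bigr do rewrite /= exprD.
rewrite big_split /=; congr (_ * _).
rewrite (bigD1 k) //= eqxx expr1 big1 ?mulr1 // => i.
by rewrite eq_sym => /negPf ->.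
Qed.

Let small_mon (l : seq I) : (forall i, count_mem i l < D)%N ->
  inspan (\prod_(j <- l) y j).
Proof.
move=> small; rewrite prod_count.
pose b := [ffun i => Ordinal (small i)].
exists 0%N, (fun b' => (b' == b)%:R); rewrite mul1r (bigD1 b) //= eqxx rmorph1 mul1r.
rewrite [X in _ + X]big1 ?addr0 => [|b' /negPf ->]; last by rewrite rmorph0 mul0r.
by apply: eq_bigr => i _; rewrite ffunE.
Qed.

(* Each use of the equation for [c * y i ^+ D] lowers the total degree. *)
Let inspan_mon n (l : seq I) : (size l <= n)%N -> inspan (\prod_(j <- l) y j).
Proof.
elim: n l => [|n IH] l sl.
  apply: small_mon => i; apply: leq_ltn_trans (count_size _ _) _.
  by apply: leq_ltn_trans sl _; exact: ltnW.
have [/small_mon //|/existsNP [i /negP]] := pselect (forall i, count_mem i l < D)%N.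
rewrite -leqNgt => geD.
pose l' := nseq (count_mem i l - D) i ++ [seq j <- l | j != i].
have pl : perm_eq l (nseq D i ++ l').
  rewrite catA -nseqD subnKC // perm_sym.
  have <- : [seq j <- l | j == i] = nseq (count_mem i l) i.
    by rewrite -size_filter; apply/all_pred1P; rewrite filter_all.
  exact/permPl/perm_filterC.
have sl' d : (d < D)%N -> (d + size l' <= n)%N.
  move=> dD; rewrite -ltnS; apply: leq_trans sl.
  by rewrite (perm_size pl) size_cat size_nseq -addSn leq_add2r.
apply: inspanMc; rewrite (perm_big _ pl) big_cat /=.
have -> : \prod_(j <- nseq D i) y j = y i ^+ D.
  by elim: (D) => [|m IHm]; rewrite ?big_nil // big_cons IHm exprS.
set P := \prod_(j <- l') y j.
(* [y_eq] trades [D] copies of [y i] for one copy, none, or a product over some [idx i t]; all have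
   fewer than [D] factors, so [sl'] gives access to [IH]. *)
have -> : iota c * (y i ^+ D * P) = \prod_(j <- i :: l') y j + iota (- a i) * P
    + \sum_t iota (- coef i t) * \prod_(j <- idx i t ++ l') y j.
  rewrite mulrA y_eq !mulrBl big_cons rmorphN mulNr mulr_suml -sumrN.
  by congr (_ + _); apply: eq_bigr => t _; rewrite rmorphN big_cat /= mulNr mulrA.
apply: inspanD; first apply: inspanD; first by apply: IH; exact: (sl' 1).
  by apply/inspanZ/IH/(sl' 0)/ltnW.
by apply: inspan_sum => t; apply/inspanZ/IH; rewrite size_cat sl'.
Qed.

(** The reduced monomials are finite in number, so one power of [c] clears the denominators of all
    products [g * mon b]; [finite_span_root] then applies. *)
Lemma deformed_system_root (lam : I -> A) :
  exists2 chi : {poly A}, chi != 0 &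
    (map_poly iota chi).[\sum_i iota (lam i) * y i] = 0.
Proof.
set g := \sum_i _.
have g_mon b : inspan (g * mon b).
  have [l ->] : exists l, mon b = \prod_(j <- l) y j.
    exists (flatten [seq nseq (b i) i | i <- enum I]).
    rewrite big_flatten big_map big_enum; apply: eq_bigr => i _.
    by elim: (b i : nat) => [|m IHm]; rewrite ?big_nil // big_cons -IHm exprS.
  rewrite mulr_suml; apply: inspan_sum => i; rewrite -mulrA; apply: inspanZ.
  by have := inspan_mon (leqnn (size (i :: l))); rewrite big_cons.
have [K /fin_all_exists [B eqB]] := fin_all_exists g_mon.
pose N := \max_b K b; have leN b : (K b <= N)%N := leq_bigmax b.
(* The zero exponent vector, whose monomial is 1. *)
pose b0 : {ffun I -> 'I_D} := [ffun=> Ordinal (ltnW D_gt1)].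
apply: (@finite_span_root _ _ iota _ mon b0 (c ^+ N) g
          (fun a b => c ^+ (N - K a) * B a b)).
- by rewrite /mon big1 // => i _; rewrite ffunE.
- by rewrite expf_neq0.
- by move=> b; rewrite rmorphXn -mulrA (inspan_lift (leN b) (eqB b)).
Qed.

End Reduction.

(** The outer polynomial variable stands for [g], the inner one for [fpsX R]. *)
Definition algebraic (R : comNzRingType) (g : fps R) :=
  exists2 chi : {poly {poly R}}, chi != 0 & (map_poly (@fps_of_poly R) chi).[g] = 0.

(* Dividing the equation over [R[t]] by powers of [t] keeps it nontrivial at
   [t = 0]. *)
Lemma algebraic_specialize (R : idomainType) (g : fps {poly R}) :
  algebraic g -> algebraic (map_fps (horner_eval (0 : R)) g).
Proof.
pose ev := horner_eval (0 : R).
move=> [chi chi0 root_chi].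
have [i [j nz]] : exists i j, chi`_i`_j != 0.
  exists (size chi).-1, (size (lead_coef chi)).-1.
  by rewrite -/(lead_coef chi) -/(lead_coef (lead_coef chi)) !lead_coef_eq0.
(* The size in [t] of one nonzero coefficient bounds how often the equation can be divided by
   [t]. *)
move: {2}(size _) (leqnn (size chi`_i`_j)) => m.
elim: m => [|m IH] in chi {chi0} root_chi nz *.
  by rewrite leqn0 size_poly_eq0 (negPf nz).
move=> sz; have [ev0|ev_nz] := eqVneq (map_poly (map_poly ev) chi) 0; last first.
  exists (map_poly (map_poly ev) chi) => //.
  have := congr1 (map_fps ev) root_chi; rewrite rmorph0 => <-.
  rewrite -horner_map -map_poly_comp -[in RHS]map_poly_comp; congr (_ .[_]).
  by apply: eq_map_poly => p /=; rewrite map_fps_of_poly.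
(* Everything vanishes at [t = 0], so [drop_poly 1] is exact division by [t]. *)
pose chi1 := map_poly (map_poly (drop_poly 1)) chi.
have chi1E k l : chi`_k`_l = 'X * chi1`_k`_l.
  rewrite !coef_map /= -[LHS](poly_take_drop 1) expr1 mulrC -[RHS]add0r.
  congr (_ + _); apply/polyP => -[|n]; rewrite coef_take_poly coef0 //=.
  have := congr1 (fun p : {poly {poly R}} => p`_k`_l) ev0.
  by rewrite !coef_map /= horner_evalE horner_coef0 !coef0.
have chi_fact : chi = 'X%:P *: chi1.
  by apply/polyP => k; apply/polyP => l; rewrite coefZ coefCM -chi1E.
apply: (IH chi1).
- move: root_chi; rewrite chi_fact map_polyZ hornerZ => /(congr1 (@fcoef _)) z.
  apply: fpsP => n; have /eqP := congr1 (@^~ n) z.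
  by rewrite fcoefCM fcoef0 mulf_eq0 polyX_eq0 => /eqP.
- by apply: contraNneq nz => z; rewrite chi1E z mulr0.
- by rewrite !coef_map /= size_drop_poly leq_subLR add1n.
Qed.

Section SystemSolution.
Variables (R : idomainType) (I J : finType) (a : I -> R)
          (coef : I -> J -> {poly R}) (idx : I -> J -> seq I).

Theorem system_algebraic_solution :
  exists2 F : I -> fps R,
    forall i, F i = fps_of_poly (a i)%:P + fpsX R *
      \sum_t fps_of_poly (coef i t) * \prod_(j <- idx i t) F j
    & forall lam : I -> R, algebraic (\sum_i fps_of_poly (lam i)%:P * F i).
Proof.
(* One unit puts [D] above all degrees, the other ensures [1 < D]. *)
pose D := (\max_i \max_t size (idx i t)).+2.
(* The deformation parameter [t], constant in the series variable. *)
pose T : {poly {poly R}} := 'X%:P.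
pose lift := map_poly (@polyC R).
pose Psi (F : I -> fps {poly R}) i := fps_of_poly (lift (a i)%:P) +
  fpsX _ * (\sum_t fps_of_poly (lift (coef i t)) * \prod_(j <- idx i t) F j
            + fps_of_poly T * F i ^+ D).
have contr n F G : (forall i, eqfps n (F i) (G i)) ->
    forall i, eqfps n.+1 (Psi F i) (Psi G i).
  move=> FG i; apply: eqfpsD; first exact: eqfpsxx.
  apply: eqfpsXM; apply: eqfpsD; last first.
    by apply: eqfpsM; [exact: eqfpsxx | exact: eqfps_exp].
  apply: eqfps_sum => t; apply: eqfpsM; first exact: eqfpsxx.
  exact: eqfps_prod.
have [Y eqY] := fps_contraction_fixpoint contr.
pose ev := horner_eval (0 : R).
have ev_lift p : map_poly ev (lift p) = p.
  by rewrite /lift -map_poly_comp map_poly_id // => r _ /=; rewrite /ev horner_evalE hornerC.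
exists (fun i => map_fps ev (Y i)) => [i|lam].
  (* At [t = 0] the deformation term disappears and the original system remains. *)
  rewrite [in LHS]eqY /Psi !(rmorphD, rmorphM) /= map_fpsX !map_fps_of_poly ev_lift.
  rewrite map_polyC /= /ev horner_evalE hornerX polyC0 rmorph0 mul0r addr0.
  rewrite rmorph_sum /=; congr (_ + _ * _); apply: eq_bigr => t _.
  by rewrite rmorphM rmorph_prod /= map_fps_of_poly ev_lift.
have -> : \sum_i fps_of_poly (lam i)%:P * map_fps ev (Y i) =
    map_fps ev (\sum_i fps_of_poly (lift (lam i)%:P) * Y i).
  by rewrite rmorph_sum; apply: eq_bigr => i _; rewrite rmorphM /= map_fps_of_poly ev_lift.
apply: algebraic_specialize.
apply: (@deformed_system_root _ _ (@fps_of_poly {poly R}) I J D (T * 'X) Y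
  (fun i => lift (a i)%:P) (fun i t => 'X * lift (coef i t)) idx).
- by rewrite mulf_neq0 ?polyX_eq0 // polyC_eq0 polyX_eq0.
- by [].
- move=> i t; rewrite ltnS ltnW // ltnS.
  apply: leq_trans (leq_bigmax i) => /=; exact: (leq_bigmax t).
- move=> i; rewrite [X in _ = X - _ - _]eqY /Psi mulrDr rmorphM -/(fpsX _).
  set Z := _ ^+ D; set P := fpsX _; set Q := \sum_t _.
  rewrite [X in _ = _ - X](_ : _ = P * Q); last first.
    rewrite mulr_sumr; apply: eq_bigr => t _; rewrite mulrA; congr (_ * _).
    exact: rmorphM.
  by rewrite [X in X - _ - _]addrC addrK addrAC subrr add0r mulrA [P * _]mulrC.
Qed.

End SystemSolution.

(** * Resolvents of linear pencils on the Fock space *)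

Lemma mulmx_excursion (R : comNzRingType) N (c : R) (C M B M' Y : 'M[R]_N) :
  C *m (M *m (c *: (B *m M'))) *m Y = C *m (M *m (c *: (B *m (M' *m Y)))).
Proof. by rewrite -!mulmxA -scalemxAl -!mulmxA. Qed.

Section Pencil.
Variables (V E : finType) (ends : E -> V * V) (N : nat).
Notation src := (dsrc ends).
Notation tgt := (dtgt ends).

Section PencilStep.
Variables (R : comNzRingType) (A : V -> 'M[R]_N) (B C : E * bool -> 'M[R]_N).

(** The operator with coefficients [A] on projections, [B] on creations and [C] on annihilations. *)
Definition pencil_step (F : V -> seq (E * bool) -> 'M[R]_N) v w : 'M[R]_N :=
  A (pstart ends v w) *m F v w
  + (if w is d :: w' then
       if tgt d == pstart ends v w' then B d *m F v w' else 0
     else 0)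
  + \sum_(d | tgt d == pstart ends v w) C d *m F v (d :: w).

(** All vacuum vectors at once: [pencil_step] never changes the end point [v], so they do not
    interact. *)
Definition pencil_vacuum (v : V) (w : seq (E * bool)) : 'M[R]_N :=
  if w is [::] then 1%:M else 0.

End PencilStep.

Variables (R : idomainType) (A : V -> 'M[R]_N) (B C : E * bool -> 'M[R]_N).

Let S := fps R.
Let emb (c : R) : S := fps_of_poly c%:P.
Let u := fpsX R.

(* [M v] is the matrix of generating functions of the excursions above a path
   starting at [v]. *)
Definition excursion_eq (M : V -> 'M[S]_N) := forall v,
  M v = 1%:M + u *: (map_mx emb (A v) *m M v
     + \sum_(d | tgt d == v)
         map_mx emb (C d) *m (M (src d) *m (u *: (map_mx emb (B d) *m M v)))).

(* Reading the path [d1 ... dm] from its end: an excursion, then for each edge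
   its final creation followed by an excursion above it. *)
Fixpoint resolvent (M : V -> 'M[S]_N) v w : 'M[S]_N :=
  if w is d :: w' then
    if tgt d == pstart ends v w' then
      M (src d) *m (u *: (map_mx emb (B d) *m resolvent M v w')) else 0
  else M v.

Lemma resolvent_cons M v d w : resolvent M v (d :: w) =
  if tgt d == pstart ends v w then
    M (src d) *m (u *: (map_mx emb (B d) *m resolvent M v w)) else 0.
Proof. by []. Qed.

(** On a nonempty path, expand the leading factor [M (src d)] by [excursion_eq]: its 1 is the
    creation of [d], its [A] term the projection part, its sum the annihilations. *)
Lemma resolventE M v w : excursion_eq M ->
  resolvent M v w = pencil_vacuum S v w + u *:
    pencil_step (fun v => map_mx emb (A v)) (fun d => map_mx emb (B d))
      (fun d => map_mx emb (C d)) (resolvent M) v w.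
Proof.
move=> eqM; rewrite /pencil_step.
under eq_bigr => d td do rewrite resolvent_cons td.
case: w => [|d w].
  by rewrite [LHS]eqM addr0.
rewrite resolvent_cons [pstart _ v (d :: w)]/= [pencil_vacuum _ _ _]/= add0r.
case: ifP => _; last first.
  rewrite mulmx0 !add0r big1 ?scaler0 // => d' _.
  by rewrite mulmx0 scaler0 mulmx0 mulmx0.
set X := map_mx _ (B d) *m _; rewrite {1}eqM mulmxDl mul1mx -scalemxAl -scalerDr.
congr (_ *: _); rewrite mulmxDl addrC mulmxA -!addrA; congr (_ + _).
rewrite addrC; congr (_ + _); rewrite mulmx_suml; apply: eq_bigr => d' _.
exact: mulmx_excursion.
Qed.

Let coefmx k (X : 'M[S]_N) : 'M[R]_N := map_mx (fun f : S => fcoef f k) X.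

(** The factor [u] in [resolventE] makes coefficient [k.+1] the image of coefficient [k] under
    [pencil_step]. *)
Lemma coef_resolvent M k v w : excursion_eq M ->
  coefmx k (resolvent M v w) = iter k (pencil_step A B C) (pencil_vacuum R) v w.
Proof.
move=> eqM.
have cmD j X Y : coefmx j (X + Y) = coefmx j X + coefmx j Y.
  by apply/matrixP=> p q; rewrite !mxE fcoefD.
have cm0 j : coefmx j 0 = 0 by apply/matrixP=> p q; rewrite !mxE fcoef0.
have cmsum j (P : pred (E * bool)) (X : E * bool -> 'M[S]_N) :
    coefmx j (\sum_(d | P d) X d) = \sum_(d | P d) coefmx j (X d).
  by elim/big_rec2: _ => [|d x y _ <-]; rewrite ?cm0 ?cmD.
have cmM j (Y : 'M[R]_N) X : coefmx j (map_mx emb Y *m X) = Y *m coefmx j X.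
  apply/matrixP=> p q; rewrite !mxE fcoef_sum; apply: eq_bigr => r _.
  by rewrite !mxE fcoefCM.
have cmu j X : coefmx j (u *: X) = if j is j'.+1 then coefmx j' X else 0.
  by apply/matrixP=> p q; case: j => [|j]; rewrite !mxE fcoefXM.
have cmvac j v' w' : coefmx j (pencil_vacuum S v' w') = if j is 0 then pencil_vacuum R v' w' else 0.
  case: w' j => [|d w1] [|j]; rewrite ?cm0 //; apply/matrixP=> p q; rewrite !mxE;
    by case: (p == q); rewrite ?fcoef0 // [LHS](fcoef_poly _ 1) coef1.
elim: k => [|k IH] in v w *.
  by rewrite (resolventE _ _ eqM) cmD cmu addr0 cmvac.
rewrite (resolventE _ _ eqM) cmD cmu cmvac add0r.
rewrite /pencil_step !cmD cmM cmsum iterS /pencil_step IH; congr (_ + _ + _).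
  by case: w => [|d w]; rewrite ?cm0 //; case: ifP => _; rewrite ?cm0 ?cmM ?IH.
by apply: eq_bigr => d _; rewrite cmM IH.
Qed.

Theorem pencil_algebraic (lam : V -> 'I_N -> 'I_N -> R) :
  algebraic ((fun k => \sum_v \sum_i \sum_j lam v i j *
    iter k (pencil_step A B C) (pencil_vacuum R) v [::] i j) : fps R).
Proof.
pose I := (V * 'I_N * 'I_N)%type.
pose J := ('I_N + (E * bool) * 'I_N * 'I_N * 'I_N)%type.
(* An excursion costs two steps; the system supplies one factor [u], and the extra ['X] is the
   other. *)
pose coef (x : I) (t : J) : {poly R} := let: (v, i, j) := x in
  match t with
  | inl k => (A v i k)%:P
  | inr (d, k1, k2, k3) => if tgt d == v then (C d i k1 * B d k2 k3) *: 'X else 0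
  end.
pose idx (x : I) (t : J) : seq I := let: (v, i, j) := x in
  match t with
  | inl k => [:: (v, k, j)]
  | inr (d, k1, k2, k3) => [:: (src d, k1, k2); (v, k3, j)]
  end.
have [F eqF alg] :=
  system_algebraic_solution (fun x : I => (x.1.2 == x.2)%:R) coef idx.
pose M v : 'M[S]_N := \matrix_(i, j) F (v, i, j).
have eqM : excursion_eq M.
  move=> v; apply/matrixP=> i j; rewrite !mxE eqF /=.
  congr (_ + _ * _); first by case: (i == j); rewrite ?rmorph0 ?rmorph1.
  rewrite big_sumType /=; congr (_ + _).
    by apply: eq_bigr => k _; rewrite big_seq1 !mxE.
  rewrite summxE [RHS]big_mkcond.
  pose G d k1 k2 k3 := fps_of_poly (if tgt d == v then (C d i k1 * B d k2 k3) *: 'X else 0) *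
    (M (src d) k1 k2 * M v k3 j).
  transitivity (\sum_d \sum_k1 \sum_k2 \sum_k3 G d k1 k2 k3).
    rewrite !pair_bigA /=; apply: eq_bigr => -[[[d k1] k2] k3] _.
    by rewrite /G !mxE big_cons big_seq1.
  apply: eq_bigr => d _; rewrite /G; case: ifP => _; last first.
    by do 3!(rewrite big1 // => ? _); rewrite rmorph0 mul0r.
  rewrite mxE; apply: eq_bigr => k1 _; rewrite !mxE mulr_sumr.
  apply: eq_bigr => k2 _; rewrite !mxE !mulr_sumr; apply: eq_bigr => k3 _; rewrite !mxE.
  rewrite -mul_polyC polyCM !rmorphM -!mulrA /=; congr (_ * _).
  by rewrite (mulrCA _ (fps_of_poly 'X)) (mulrCA _ (F _)) mulrCA.
have := alg (fun x => lam x.1.1 x.1.2 x.2).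
congr (algebraic _); apply: fpsP => k; rewrite fcoef_sum /fcoef.
rewrite !pair_bigA /=; apply: eq_bigr => -[[v i] j] _ /=.
rewrite -(coef_resolvent k _ _ eqM) !mxE /=.
exact: fcoefCM.
Qed.

End Pencil.

(** * Algebraic series *)

Lemma algebraicP (R : comNzRingType) (f : fps R) :
  algebraic f <-> exists n (q : nat -> {poly R}),
    (exists2 j, (j < n)%N & q j != 0) /\
    \sum_(j < n) fps_of_poly (q j) * f ^+ j = 0.
Proof.
split=> [[chi chi0 root_chi]|[n [q [[j jn qj] root_q]]]].
  exists (size chi), (fun j => chi`_j); split.
    exists (size chi).-1; first by rewrite prednK // size_poly_gt0.
    by rewrite -/(lead_coef chi) lead_coef_eq0.
  rewrite -[RHS]root_chi (@horner_coef_wide _ (size chi)) ?size_poly //.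
  by apply: eq_bigr => j _; rewrite coef_map.
exists (\poly_(j < n) q j).
  by apply: contraNneq qj => /(congr1 (fun p : {poly _} => p`_j)); rewrite coef_poly jn coef0 => ->.
rewrite -[RHS]root_q (@horner_coef_wide _ n); last first.
  by rewrite (leq_trans (size_poly _ _)) ?size_poly.
by apply: eq_bigr => i _; rewrite coef_map coef_poly ltn_ord.
Qed.

(** Multiplying the equation by [u ^ n] lets each [f ^+ j] absorb [j] factors [u]. *)
Lemma algebraic_mulX (R : idomainType) (f : fps R) :
  algebraic f -> algebraic (fpsX R * f).
Proof.
move=> /algebraicP [n [q [[j jn qj] root_q]]]; apply/algebraicP.
exists n, (fun j => q j * 'X^(n - j)); split.
  by exists j => //; rewrite mulf_neq0 // expf_neq0 // polyX_eq0.
transitivity (fpsX R ^+ n * 0); last exact: mulr0.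
rewrite -[in RHS]root_q mulr_sumr; apply: eq_bigr => i _.
rewrite rmorphM rmorphXn -/(fpsX R) exprMn -mulrA (mulrA (_ ^+ (n - i))) -exprD.
by rewrite subnK 1?ltnW // mulrCA.
Qed.

(** Here [g(u) = f(u ^ l)]. Extracting the exponents congruent to [r] commutes with multiplication
    by series in [u ^ l], so it turns an equation for [g] into one for [f]. *)
Lemma algebraic_descent (R : comNzRingType) (l : nat) (f g : fps R) :
  (0 < l)%N ->
  (forall k, fcoef g k = if (l %| k)%N then fcoef f (k %/ l)%N else 0) ->
  algebraic g -> algebraic f.
Proof.
move=> l0 gE /algebraicP [n [q [[j jn qj] root_q]]]; apply/algebraicP.
have lead_qj : (q j)`_(size (q j)).-1 != 0 by rewrite -/(lead_coef _) lead_coef_eq0.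
(* The residue of the degree of a nonzero [q j] is chosen, so its leading coefficient survives the
   extraction. *)
set i0 := _.-1 in lead_qj; pose r := (i0 %% l)%N.
pose section (h : fps R) : fps R := fun k => fcoef h (r + l * k)%N.
have sectionM h : section (h * g) = section h * f.
  apply: fpsP => k; rewrite [h * g]mulrC [_ * f]mulrC [LHS]fcoefM fcoefM.
  rewrite (bigID (fun i : 'I__ => l %| i)%N) /= [X in _ + X]big1 ?addr0; last first.
    by move=> i /negPf ni; rewrite gE ni mul0r.
  have bound (e : 'I_k.+1) : (l * e < (r + l * k).+1)%N.
    by rewrite ltnS (leq_trans _ (leq_addl _ _)) // leq_mul2l -ltnS ltn_ord orbT.
  rewrite (reindex_onto (fun e => Ordinal (bound e)) (fun i => inord (i %/ l)%N)) /=.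
    apply: eq_big => [e|e _]; last first.
      rewrite gE dvdn_mulr // mulKn //; congr (_ * fcoef _ _).
      by rewrite -addnBA ?mulnBr // leq_mul2l -ltnS ltn_ord orbT.
    by rewrite dvdn_mulr // mulKn // inord_val eqxx.
  move=> i li; apply: val_inj => /=; rewrite inordK; first by rewrite mulnC divnK.
  rewrite ltn_divLR // mulSn; apply: leq_trans (ltn_ord i) _.
  by rewrite -addSn (mulnC l k) leq_add2r ltn_pmod.
have sectionMX h i : section (h * g ^+ i) = section h * f ^+ i.
  by elim: i h => [|i IH] h; rewrite ?mulr1 // !exprS !mulrA IH sectionM.
pose q' i := \poly_(k < size (q i)) (q i)`_(r + l * k)%N.
have q'E i k : (q' i)`_k = (q i)`_(r + l * k)%N.
  rewrite coef_poly; case: ltnP => // le; rewrite nth_default //.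
  by apply: leq_trans le (leq_trans _ (leq_addl _ _)); rewrite leq_pmull.
exists n, q'; split.
  exists j => //; apply: contraNneq lead_qj => /(congr1 (fun p : {poly _} => p`_(i0 %/ l)%N)).
  by rewrite q'E coef0 addnC mulnC -divn_eq => ->.
apply: fpsP => k; rewrite fcoef0.
transitivity (fcoef (section (\sum_(j < n) fps_of_poly (q j) * g ^+ j)) k); last first.
  by rewrite root_q.
rewrite [RHS]fcoef_sum fcoef_sum; apply: eq_bigr => i _.
rewrite -[RHS]/(fcoef (section _) k) sectionMX.
congr (fcoef (_ * _) _); by apply: fpsP => d; rewrite fcoef_poly q'E.
Qed.

Lemma algebraic_cauchy_of_fps (m : nat -> CC) :
  algebraic (m : fps CC) -> algebraic_cauchy m.
Proof.
move=> /algebraic_mulX /algebraicP [[|M] [q [[j jM qj] root_q]]] //.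
exists M, (fun i => q i); split; first by exists (Ordinal jM).
move=> N d dN; rewrite -fcoef_poly rmorph_sum.
(* The truncation keeps the exponents 1 to [N], hence is exact up to degree [N]. *)
have trunc : eqfps N.+1 (fps_of_poly (cauchy_trunc m N)) (fpsX _ * (m : fps CC)).
  move=> k kN; rewrite fcoefXM fcoef_poly /cauchy_trunc coef_sum.
  case: k kN => [|k] kN; first by apply: big1 => i _; rewrite coefZ coefXn mulr0.
  rewrite (bigD1 (Ordinal (kN : (k < N)%N))) //= coefZ coefXn eqxx mulr1 big1 ?addr0 // => i neq.
  rewrite coefZ coefXn eqSS; case: eqP => [e|_]; last by rewrite mulr0.
  by case/eqP: neq; apply: val_inj.
transitivity (fcoef (0 : fps CC) d); last by [].
rewrite -[in RHS]root_q.
have H : eqfps N.+1 (\sum_(i < M.+1) fps_of_poly (q i * cauchy_trunc m N ^+ i))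
    (\sum_(i < M.+1) fps_of_poly (q i) * (fpsX CC * (m : fps CC)) ^+ i).
  apply: eqfps_sum => i; rewrite rmorphM rmorphXn.
  by apply: eqfpsM; [exact: eqfpsxx | exact: eqfps_exp].
exact: H.
Qed.

(** * Linearization *)

Section Monomials.
Variables (V E : finType) (ends : E -> V * V) (mu : V -> RR).
Implicit Types (f : Vec V E) (v : V).

Inductive letter :=
| LProj of V
| LCre of E * bool
| LAnn of E * bool
| LScal of CC.

Definition linterp (l : letter) : Op V E :=
  match l with
  | LProj a => proj ends a
  | LCre d => cre ends d
  | LAnn d => ann ends d
  | LScal c => fun f v w => c * f v w
  end.

Definition winterp (s : seq letter) : Op V E := fun f => foldr linterp f s.

Lemma winterp_cat s t f : winterp (s ++ t) f = winterp s (winterp t f).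
Proof. exact: foldr_cat. Qed.

Lemma linterp_sum l I (r : seq I) (P : pred I) (F : I -> Vec V E) :
  linterp l (fun v w => \sum_(i <- r | P i) F i v w)
  = fun v w => \sum_(i <- r | P i) linterp l (F i) v w.
Proof.
apply/funext => v; apply/funext => w.
case: l => [a|d|d|c] /=; last by rewrite mulr_sumr.
- by rewrite /proj; case: ifP => // _; rewrite big1.
- rewrite /cre; case: w => [|d' w]; first by rewrite big1.
  by case: ifP => // _; rewrite big1.
- by rewrite /ann; case: ifP => // _; rewrite big1.
Qed.

Lemma linterp0 l v w : linterp l (fun _ _ => 0) v w = 0.
Proof.
case: l => [a|d|d|c] /=; rewrite ?mulr0 // /proj /cre /ann ?if_same //.
by case: w => // d' w; rewrite if_same.
Qed.

Lemma winterp_sum s I (r : seq I) (F : I -> Vec V E) :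
  winterp s (fun v w => \sum_(i <- r) F i v w)
  = fun v w => \sum_(i <- r) winterp s (F i) v w.
Proof. by elim: s => [|l s /= IH] //; rewrite IH linterp_sum. Qed.

(** Letters modify a path only at its start, so different end points never mix. *)
Lemma linterp_local l f g v : (forall w, f v w = g v w) ->
  forall w, linterp l f v w = linterp l g v w.
Proof.
move=> fg w; case: l => [a|d|d|c] /=; rewrite /proj /cre /ann ?fg //.
by case: w => [|d' w]; rewrite ?fg.
Qed.

Lemma winterp_local s f g v : (forall w, f v w = g v w) ->
  forall w, winterp s f v w = winterp s g v w.
Proof. by move=> fg; elim: s => [|l s IH] //=; exact: linterp_local. Qed.

Definition Xe_mons (e : E) : seq (seq letter) :=
  let a : CC := (Num.sqrt (Num.sqrt (mu (ends e).1 / mu (ends e).2)))%:C%C in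
  if (ends e).1 == (ends e).2 then [:: [:: LCre (e, true)]; [:: LAnn (e, true)]]
  else [:: [:: LScal a; LCre (e, true)]; [:: LScal a^-1; LAnn (e, false)];
           [:: LScal a^-1; LCre (e, false)]; [:: LScal a; LAnn (e, true)]].

Fixpoint mons (x : aexpr V E) : seq (seq letter) :=
  match x with
  | AP a => [:: [:: LProj a]]
  | AX d => [seq LProj (dsrc ends d) :: rcons m (LProj (dtgt ends d)) | m <- Xe_mons d.1]
  | AS c => [:: [:: LScal c]]
  | AAdd x y => mons x ++ mons y
  | AMul x y => [seq s ++ t | s <- mons x, t <- mons y]
  end.

Lemma interp_mons x f :
  interp ends mu x f = fun v w => \sum_(s <- mons x) winterp s f v w.
Proof.
elim: x f => [a|d|c|x IHx y IHy|x IHx y IHy] f;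
  apply/funext => v; apply/funext => w /=.
- by rewrite big_seq1.
- rewrite big_map /Xd.
  have -> : Xe ends mu d.1 (proj ends (dtgt ends d) f) = fun v w =>
      \sum_(s <- Xe_mons d.1) winterp s (proj ends (dtgt ends d) f) v w.
    apply/funext => v'; apply/funext => w'; rewrite /Xe /Xe_mons.
    by case: ifP => _; rewrite !big_cons big_nil addr0 //= !addrA.
  have /= -> := linterp_sum (LProj (dsrc ends d)); apply: eq_bigr => s _.
  by rewrite -cats1 winterp_cat.
- by rewrite big_seq1.
- by rewrite big_cat IHx IHy.
- rewrite big_allpairs_dep IHx IHy; apply: eq_bigr => s _; rewrite winterp_sum.
  by apply: eq_bigr => t _; rewrite winterp_cat.
Qed.

(** First of the three coordinates of a letter as a pencil; a scalar is that multiple of the sum of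
    all projections. *)
Definition letterP (l : letter) (v : V) : CC :=
  match l with LProj a => (v == a)%:R | LScal c => c | _ => 0 end.
Definition letterC (l : letter) (d : E * bool) : CC :=
  if l is LCre d' then (d == d')%:R else 0.
Definition letterA (l : letter) (d : E * bool) : CC :=
  if l is LAnn d' then (d == d')%:R else 0.

Lemma linterp_coef l f v w : linterp l f v w =
  letterP l (pstart ends v w) * f v w
  + (if w is d :: w' then
       if dtgt ends d == pstart ends v w' then letterC l d * f v w' else 0
     else 0)
  + \sum_(d | dtgt ends d == pstart ends v w) letterA l d * f v (d :: w).
Proof.
case: l => [a|d|d|c] /=.
- rewrite /proj big1 => [|d _]; last by rewrite mul0r.
  rewrite addr0 [X in _ + X](_ : _ = 0); last first.
    by case: w => // d w; rewrite mul0r if_same.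
  by rewrite addr0; case: eqP; rewrite ?mul1r ?mul0r.
- rewrite mul0r add0r big1 ?addr0 => [|d' _]; last by rewrite mul0r.
  rewrite /cre; case: w => // d' w; have [->|_] := eqVneq d' d.
    by rewrite mul1r.
  by rewrite mul0r if_same.
- rewrite mul0r add0r [X in X + _](_ : _ = 0); last first.
    by case: w => // d' w; rewrite mul0r if_same.
  rewrite add0r /ann; case: ifP => td.
    rewrite (bigD1 d) //= eqxx mul1r big1 ?addr0 // => d' /andP [_ /negPf ->].
    by rewrite mul0r.
  rewrite big1 // => d' td'; case: eqP => [e|_]; last by rewrite mul0r.
  by rewrite -e td' in td.
- rewrite [X in _ + X + _](_ : _ = 0); last first.
    by case: w => // d w; rewrite mul0r if_same.
  by rewrite big1 ?addr0 // => d _; rewrite mul0r.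
Qed.

End Monomials.

(** * A finite automaton producing the powers of [x] *)

Section Linearization.
Variables (V E : finType) (ends : E -> V * V) (mu : V -> RR).
Variables (n : nat) (x : 'I_n -> 'I_n -> aexpr V E).
Notation letter := (letter V E).
Let ms i j := mons ends mu (x i j).

Let L := (\sum_i \sum_j \sum_(s <- ms i j) size s)%N.
Let K := (\sum_i \sum_j size (ms i j)).+1%N.

(** Padding by identity letters gives every monomial length [L]; indices beyond the list give a
    dummy word, which [transition] never enters. *)
Let word i j k : seq letter :=
  let s := nth [::] (ms i j) k in s ++ nseq (L - size s) (LScal _ _ 1).

Let size_word i j k : size (word i j k) = L.
Proof.
rewrite size_cat size_nseq subnKC //.
apply: (@leq_trans (\sum_(s <- ms i j) size s)%N); last first.
  by rewrite /L (bigD1 i) //= (bigD1 j) //= -addnA leq_addr.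
elim: (ms i j) k => [|s r IH] [|k] //=; rewrite big_cons ?leq_addr //.
exact: leq_trans (IH k) (leq_addl _ _).
Qed.

Let winterp_word i j k f :
  winterp ends (word i j k) f = winterp ends (nth [::] (ms i j) k) f.
Proof.
rewrite winterp_cat; congr (winterp _ _ _); elim: (_ - _)%N => [|m IH] //=.
by rewrite IH; apply/funext => v; apply/funext => w; rewrite mul1r.
Qed.

Let leK i j : (size (ms i j) <= K)%N.
Proof. by rewrite ltnW // ltnS /K (bigD1 i) //= (bigD1 j) //= -addnA leq_addr. Qed.

Let Q := ('I_n * 'I_n * 'I_K * 'I_L.+1)%type.

(* In state [(i, j, r, p)] the letters of the [r]-th monomial of [x i j] from
   position [p] on remain to be applied; from [p = L] an idle step leads to the
   beginning of a monomial of row [j]. *)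
Definition transition (q q' : Q) : letter :=
  let: (i, j, k, p) := q in
  if (p < L)%N then
    if q' == (i, j, k, inord p.+1) then nth (LScal _ _ 1) (word i j k) p
    else LScal _ _ 0
  else
    let: (i', j', k', p') := q' in
    if [&& i' == j, (k' < size (ms i' j'))%N & p' == ord0] then LScal _ _ 1
    else LScal _ _ 0.

Let vac : Vec V E := fun v w => if w is [::] then 1 else 0.
Let power i0 m := iter m (mact ends mu x) (fun j => if j == i0 then vac else fun _ _ => 0).

Let final i0 (q : Q) : bool := (q.1.1.2 == i0) && (q.2 == ord_max).

(** From position [p], [L - p] steps finish the current word, and each further factor [x] costs one
    idle step and [L] letters. Hence only [k = L - p + m * L.+1] contributes, with the [m]-th
    power. *)
Lemma transition_power i0 (Z : nat -> Q -> Vec V E) :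
  (forall q v w, Z 0%N q v w = if final i0 q then vac v w else 0) ->
  (forall k q v w, Z k.+1 q v w =
     \sum_q' linterp ends (transition q q') (Z k q') v w) ->
  forall k i j r p v w, Z k (i, j, r, p) v w =
    if (L.+1 %| (k + p).+1)%N then
      winterp ends (drop p (word i j r)) (power i0 ((k + p).+1 %/ L.+1).-1 j) v w
    else 0.
Proof.
move=> Z0 ZS; elim=> [|k IH] i j r p v w.
  rewrite Z0 /final /= add0n; have [pL|pL] := eqVneq p ord_max.
    rewrite andbT pL /= dvdnn divnn /= drop_oversize ?size_word //=.
    by case: ifP.
  rewrite andbF gtnNdvd // ltnS ltn_neqAle -ltnS ltn_ord andbT.
  by apply: contraNneq pL => e; apply/eqP/val_inj.
rewrite ZS /transition; have [pL|] := ltnP p L.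
  rewrite (bigD1 (i, j, r, inord p.+1)) //= eqxx big1 ?addr0 => [|q' /negPf ->]; last first.
    by rewrite /= mul0r.
  have -> : Z k (i, j, r, inord p.+1) = fun v w => if (L.+1 %| (k.+1 + p).+1)%N then
      winterp ends (drop p.+1 (word i j r)) (power i0 ((k.+1 + p).+1 %/ L.+1).-1 j) v w
    else 0.
    by apply/funext => v'; apply/funext => w'; rewrite IH inordK // addnS addSn.
  case: ifP => _; last by rewrite linterp0.
  by rewrite [in RHS](@drop_nth _ (LScal _ _ 1) p) ?size_word.
move=> Lp; have {Lp} pL : nat_of_ord p = L.
  by apply/eqP; rewrite eqn_leq Lp -ltnS ltn_ord.
pose G (a b : 'I_n) (c : 'I_K) (d : 'I_L.+1) :=
  if [&& a == j, (c < size (ms a b))%N & d == ord0] then Z k (a, b, c, d) v w else 0.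
transitivity (\sum_a \sum_b \sum_c \sum_d G a b c d).
  rewrite !pair_bigA; apply: eq_bigr => -[[[a b] c] d] _; rewrite /= /G.
  by case: ifP => _ /=; rewrite ?mul1r ?mul0r.
transitivity (\sum_b \sum_(c < K | (c < size (ms j b))%N) Z k (j, b, c, ord0) v w).
  rewrite (bigD1 j) //= [X in _ + X]big1 ?addr0 => [|a /negPf aj]; last first.
    by do 3!(rewrite big1 // => ? _); rewrite /G aj.
  apply: eq_bigr => b _; rewrite [RHS]big_mkcond; apply: eq_bigr => c _.
  rewrite (bigD1 ord0) //= big1 ?addr0 => [|d /negPf d0]; last by rewrite /G d0 !andbF.
  by rewrite /G !eqxx andbT.
rewrite pL drop_oversize ?size_word //= -addnS dvdn_addl // divnDr // divnn addn1 /=.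
case: ifP => dvd; last first.
  by do 2!(rewrite big1 // => ? _); rewrite IH addn0 dvd.
(* [k.+1] is a positive multiple of [L.+1], so the idle step can be matched with one factor [x] of
   [power]. *)
have -> : (k.+1 %/ L.+1 = (k.+1 %/ L.+1).-1.+1)%N.
  by rewrite prednK // divn_gt0 // dvdn_leq.
set m := _.-1; rewrite /power iterS -/(power i0 m) {1}/mact.
apply: eq_bigr => b _; rewrite interp_mons (big_nth [::]) big_mkord.
rewrite (big_ord_widen _ (fun c => winterp ends (nth [::] _ c) _ v w) (leK j b)).
by apply: eq_bigr => c _; rewrite IH addn0 dvd drop0 winterp_word.
Qed.

Let N := #|{: Q}|.
Let enc : Q -> 'I_N := enum_rank.
Let dec : 'I_N -> Q := enum_val.
Let encK : cancel enc dec := enum_rankK.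
Let decK : cancel dec enc := enum_valK.
Let A v : 'M[CC]_N := \matrix_(a, b) letterP (transition (dec a) (dec b)) v.
Let B d : 'M[CC]_N := \matrix_(a, b) letterC (transition (dec a) (dec b)) d.
Let C d : 'M[CC]_N := \matrix_(a, b) letterA (transition (dec a) (dec b)) d.
Let codeM (f : Q -> Q -> CC) (Y : 'M[CC]_N) q b :
  ((\matrix_(a, c) f (dec a) (dec c)) *m Y) (enc q) b
  = \sum_q' f q q' * Y (enc q') b.
Proof.
rewrite mxE (reindex enc) /=; last by exists dec => ? _; rewrite ?encK ?decK.
by apply: eq_bigr => q' _; rewrite mxE !encK.
Qed.

Let P k := iter k (pencil_step ends A B C) (@pencil_vacuum V E N CC).

(** Summing the final columns amounts to starting the pencil from the vacuum placed in every final
    state. *)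
Let Z i0 k q : Vec V E := fun v w => \sum_(b | final i0 (dec b)) P k v w (enc q) b.

Let Z0 i0 q v w : Z i0 0 q v w = if final i0 q then vac v w else 0.
Proof.
rewrite /Z /P /= /pencil_vacuum /vac; case: w => [|d w]; last first.
  by rewrite if_same big1 // => b _; rewrite mxE.
case: ifP => fq.
  rewrite (bigD1 (enc q)) /= ?encK // mxE eqxx big1 ?addr0 // => b /andP [_ /negPf].
  by rewrite mxE eq_sym => ->.
rewrite big1 // => b fb; rewrite mxE; case: eqP => // e.
by rewrite -e encK fq in fb.
Qed.

Let ZS i0 k q v w :
  Z i0 k.+1 q v w = \sum_q' linterp ends (transition q q') (Z i0 k q') v w.
Proof.
rewrite /Z; under [RHS]eq_bigr do rewrite linterp_sum.
rewrite exchange_big; apply: eq_bigr => b _.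
rewrite /P iterS -/(P k) /pencil_step mxE mxE.
rewrite (codeM (fun q q' => letterP (transition q q') _)).
under [RHS]eq_bigr do rewrite linterp_coef.
rewrite !big_split /=; congr (_ + _ + _).
  case: w => [|d w]; first by rewrite mxE big1.
  case: ifP => _; last by rewrite mxE big1.
  exact: (codeM (fun q q' => letterC (transition q q') _)).
rewrite summxE exchange_big; apply: eq_bigr => d _.
exact: (codeM (fun q q' => letterA (transition q q') _)).
Qed.

(** [power] starts from all vacua together, [moment] from one; at end point [v0] they agree by
    locality. *)
Lemma power_local i0 m v0 : forall i w,
  power i0 m i v0 w = iter m (mact ends mu x)
    (fun j => if j == i0 then basis v0 [::] else fun _ _ => 0) i v0 w.
Proof.
elim: m => [|m IH] i w /=.
  by case: ifP => // _; rewrite /vac /basis eqxx; case: w.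
rewrite {1 3}/mact; apply: eq_bigr => j _; rewrite !interp_mons.
by apply: eq_bigr => s _; apply: winterp_local => w'; exact: IH.
Qed.

Lemma moment_algebraic : algebraic (moment ends mu x : fps CC).
Proof.
(* Starting at position [L] makes exactly the multiples of [L.+1] contribute, without shift, as
   [algebraic_descent] requires. *)
pose start i : Q := (i, i, ord0, ord_max).
pose lam v a b : CC := \sum_i
  n%:R^-1 * (mu v)%:C%C * (a == enc (start i))%:R * (final i (dec b))%:R.
apply: (algebraic_descent (l := L.+1) _ _ (@pencil_algebraic V E ends N CC A B C lam)) => //.
move=> k; rewrite /fcoef -/(P k).
transitivity (\sum_v \sum_i n%:R^-1 * (mu v)%:C%C * Z i k (start i) v [::]).
  apply: eq_bigr => v _; rewrite /lam.
  under eq_bigr => a _ do under eq_bigr => b _ do rewrite mulr_suml.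
  under eq_bigr => a _ do rewrite exchange_big.
  rewrite exchange_big; apply: eq_bigr => i _ /=.
  rewrite (bigD1 (enc (start i))) //= [X in _ + X]big1 ?addr0 => [|a /negPf ->]; last first.
    by rewrite big1 // => b _; rewrite mulr0 !mul0r.
  rewrite eqxx mulr1 mulr_sumr [RHS]big_mkcond; apply: eq_bigr => b _.
  by case: (final i _); rewrite ?mulr1 // mulr0 mul0r.
under eq_bigr => v _ do under eq_bigr => i _ do
  rewrite (transition_power (Z0 i) (ZS i)) /= -addnS dvdn_addl //.
case: ifP => dvd; last first.
  by do 2!(rewrite big1 // => ? _); rewrite mulr0.
rewrite /moment mulr_sumr exchange_big; apply: eq_bigr => i _.
rewrite mulr_sumr; apply: eq_bigr => v _; rewrite mulrA.
rewrite drop_oversize ?size_word //= power_local.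
by rewrite divnDr // divnn addn1.
Qed.

End Linearization.

Theorem theorem3p2 (V E : finType) (ends : E -> V * V) (mu : V -> RR)
  (n : nat) (x : 'I_n -> 'I_n -> aexpr V E) :
  connected_graph ends ->
  (forall v, 0 < mu v) ->
  (0 < n)%N ->
  selfadjoint_mx ends mu x ->
  algebraic_cauchy (moment ends mu x).
Proof. by move=> _ _ _ _; exact/algebraic_cauchy_of_fps/moment_algebraic. Qed.
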